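(* The unit space of $\mathcal G_{\mathrm{tight}}$ is, under the identification $[(x,1)]\leftrightarrow x$, $$\mathcal G_{\mathrm{tight}}^0\cong\{\phi(k_1,k_2),\ \phi(k_1,\infty),\ \phi(\infty,k_2),\ \phi(\infty,\infty):k_1,k_2\in\mathbb N\}\cong\widehat E_\infty.$$
   Context: $\mathbb N=\{0,1,2,\dots\}$, $\overline{\mathbb N}=\mathbb N\cup\{\infty\}$. $S$ is the left shift on $\ell^2(\mathbb N)$ ($Se_0=0$, $Se_n=e_{n-1}$), $p$ is the rank-one projection onto $\mathbb Ce_0$, and $\bm t$ is the left shift on $\ell^2(\mathbb Z)$ ($\bm te_n=e_{n-1}$). The inverse semigroup $T$ of operators on $\ell^2(\mathbb N)\otimes\ell^2(\mathbb N)\otimes\ell^2(\mathbb Z)$: for $\bm n=(n_1,n_2),\bm m=(m_1,m_2)\in\mathbb N^2$, $r\in\mathbb Z$, let $B_1(r,\bm n,\bm m)=S^{*n_1}S^{m_1}\otimes S^{*n_1}S^{m_1}\otimes\bm t^r$ for $n_1=n_2$, $m_1=m_2$, $r=m_1-n_1$; $B_2(r,\bm n,\bm m)=S^{*n_1}S^{m_1}\otimes S^{*n_2}pS^{m_2}\otimes\bm t^r$ for $r=m_1-n_1$, $n_1\ge n_2$, $m_1\ge m_2$; $B_3(r,\bm n,\bm m)=S^{*n_1}pS^{m_1}\otimes S^{*n_2}S^{m_2}\otimes\bm t^r$ for $r=m_2-n_2$, $n_1\le n_2$, $m_1\le m_2$; $B_4(r,\bm n,\bm m)=S^{*n_1}pS^{m_1}\otimes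 S^{*n_2}pS^{m_2}\otimes\bm t^r$ for any $r\in\mathbb Z$. $T$ is the set of all these operators together with $0$, an inverse semigroup under operator product and adjoint. $E$ is its commutative semigroup of projections, ordered by $e\le f\iff fe=e$; its nonzero elements are $P_i(\bm n)=B_i(0,\bm n,\bm n)$ (with $n_1=n_2$ if $i=1$; $n_1\ge n_2$ if $i=2$; $n_1\le n_2$ if $i=3$). $\widehat E_0$ is the set of nonzero semigroup homomorphisms $x:E\to\{0,1\}$ with $x(0)=0$, with the subspace topology from $\{0,1\}^E$. A filter is a nonempty $A\subseteq E\setminus\{0\}$ that is upward closed and closed under products; ultrafilters are maximal filters. $\widehat E_\infty=\{x\in\widehat E_0:x^{-1}(1)\text{ is an ultrafilter}\}$ and $\widehat E_{\mathrm{tight}}$ is its closure in $\widehat E_0$. For $\bm k\in\overline{\mathbb N}^2$ put $\Lambda(\bm k)=\{P_4(\bm k)\}$ if $\bm k\in\mathbb N^2$; $\Lambda(k_1,\infty)=\{P_3((k_1,l)):l\in\mathbb N,\ l\ge k_1\}$ and $\Lambda(\infty,k_2)=\{P_2((l,k_2)):l\in\mathbb N,\ l\ge k_2\}$ for $k_1,k_2\in\mathbb N$; $\Lambda(\infty,\infty)=\{P_1((l,l)):l\in\mathbb N\}$. Let $A_{\Lambda(\bm k)}=\{f\in E:fe=e\text{ for some }e\in\Lambda(\bm k)\}$ and $\phi(\bm k)=1_{A_{\Lambda(\bm k)}}$. For $s\in T$ let $D_s=\{x\in\widehat E_0:x(ss^* )=1\}$, and for $x\in D_s$ let $(x\cdot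 s)(e)=x(ses^* )$. Let $\Sigma=\{(x,s):s\in T,\ x\in D_s\}$, with $(x,s)\sim(y,s')$ iff $x=y$ and $es=es'$ for some $e\in E$ with $x(e)=1$. $\mathcal G'=\Sigma/\sim$ is a groupoid with $[(x,s)][(x\cdot s,s')]=[(x,ss')]$, $[(x,s)]^{-1}=[(x\cdot s,s^* )]$, and $\mathcal G_{\mathrm{tight}}$ is the reduction of $\mathcal G'$ to $\widehat E_{\mathrm{tight}}$. The unit space of a groupoid $\mathcal G$ is $\mathcal G^0=\{aa^{-1}:a\in\mathcal G\}$. *)

(* Defs.v *)
From HB Require Import structures.
From mathcomp Require Import all_boot all_order all_algebra finmap.
From mathcomp Require Import all_classical all_reals all_analysis.
From mathcomp Require Import complex.
From mathcomp.analysis.showcase Require Import summability.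

Set Implicit Arguments.
Unset Strict Implicit.
Unset Printing Implicit Defensive.

Import Order.TTheory GRing.Theory Num.Theory.
Import numFieldNormedType.Exports.

Local Open Scope classical_set_scope.
Local Open Scope ring_scope.

Section Ell2.
Context (R : realType).

Definition square_summable (X : choiceType) (f : X -> R[i]) : bool :=
  (\esum_(x in [set: X]) (complex.Re (f x) ^+ 2 + complex.Im (f x) ^+ 2)%:E
     < +oo)%E.

Record ell2 (X : choiceType) : Type := Ell2 {
  coef :> X -> R[i];
  coef_square_summable : square_summable coef
}.

HB.instance Definition _ (X : choiceType) := [isSub for @coef X].
HB.instance Definition _ (X : choiceType) := [Choice of ell2 X by <:].

Lemma square_summable0 (X : choiceType) :
  square_summable (fun _ : X => 0 : R[i]).
Proof.
rewrite /square_summable esum1 ?ltry// => x _ /=.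
by rewrite expr0n /= addr0.
Qed.

Definition ell2_0 (X : choiceType) : ell2 X := Ell2 (square_summable0 X).

(* The vector with coefficients f. The default 0 is never reached below: all
   the families to which it is applied are square summable, because the
   operators in play are bounded. *)
Definition to_ell2 (X : choiceType) (f : X -> R[i]) : ell2 X :=
  insubd (ell2_0 X) f.

(* Linear in the first argument; the sum is the unconditional one, i.e. the
   limit of the partial sums along the finite subsets of X. *)
Definition inner (X : choiceType) (f g : ell2 X) : R[i] :=
  summability.sum (fun x => f x * (g x)^* : (R[i])^o).

Definition operator (X : choiceType) : Type := ell2 X -> ell2 X.

Definition op0 (X : choiceType) : operator X := fun=> ell2_0 X.

Definition is_adjoint (X : choiceType) (A B : operator X) : Prop :=
  forall f g : ell2 X, inner (A f) g = inner f (B g).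

Definition adj (X : choiceType) (A : operator X) : operator X :=
  xget (@op0 X) (is_adjoint A).

(* l^2(X) (x) l^2(Y) is identified with l^2(X * Y) through
   e_x (x) e_y = e_(x, y). Under this identification A (x) B lets B act on the
   second variable and then A on the first one. *)
Definition tensor (X Y : choiceType) (A : operator X) (B : operator Y) :
    operator (X * Y)%type :=
  fun f => to_ell2 (fun p =>
    A (to_ell2 (fun x => B (to_ell2 (fun y => f (x, y))) p.2)) p.1).

Definition shift : operator nat := fun f => to_ell2 (fun n => f n.+1).

Definition proj0 : operator nat :=
  fun f => to_ell2 (fun n => if n == 0%N then f n else 0).

Definition bishift : operator int := fun f => to_ell2 (fun z => f (z + 1)).

(* bishift is unitary, so that its inverse is its adjoint. *)
Definition bishift_pow (r : int) : operator int :=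
  match r with
  | Posz n => iter n bishift
  | Negz n => iter n.+1 (adj bishift)
  end.

End Ell2.

Notation "A ⊗ B" := (tensor A B) (at level 40, left associativity).

Section InverseSemigroup.
Context (R : realType).

Definition op : Type := operator R (nat * nat * int)%type.

Definition SS (n m : nat) : operator R nat :=
  iter n (adj (@shift R)) \o iter m (@shift R).
Definition SpS (n m : nat) : operator R nat :=
  iter n (adj (@shift R)) \o @proj0 R \o iter m (@shift R).

Definition B1 (r : int) (n m : nat * nat) : op :=
  SS n.1 m.1 ⊗ SS n.1 m.1 ⊗ bishift_pow r.
Definition B2 (r : int) (n m : nat * nat) : op :=
  SS n.1 m.1 ⊗ SpS n.2 m.2 ⊗ bishift_pow r.
Definition B3 (r : int) (n m : nat * nat) : op :=
  SpS n.1 m.1 ⊗ SS n.2 m.2 ⊗ bishift_pow r.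
Definition B4 (r : int) (n m : nat * nat) : op :=
  SpS n.1 m.1 ⊗ SpS n.2 m.2 ⊗ bishift_pow r.

Inductive T : set op :=
| T_0 : T (@op0 R _)
| T_B1 r n m of n.1 = n.2 & m.1 = m.2 & r = m.1%:Z - n.1%:Z : T (B1 r n m)
| T_B2 r n m of r = m.1%:Z - n.1%:Z & (n.1 >= n.2)%N & (m.1 >= m.2)%N :
    T (B2 r n m)
| T_B3 r n m of r = m.2%:Z - n.2%:Z & (n.1 <= n.2)%N & (m.1 <= m.2)%N :
    T (B3 r n m)
| T_B4 r n m : T (B4 r n m).

Definition E : set op := [set e | [/\ T e, e \o e = e & adj e = e]].

Definition op_le (e f : op) : Prop := f \o e = e.

Definition P1 (n : nat * nat) : op := B1 0 n n.
Definition P2 (n : nat * nat) : op := B2 0 n n.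
Definition P3 (n : nat * nat) : op := B3 0 n n.
Definition P4 (n : nat * nat) : op := B4 0 n n.

Definition char : topologicalType := {ptws E -> bool}.

(* x(a) for an operator a which is meant to belong to E: it is only applied to
   0, to products in E and to operators of the form s s^* and s e s^* . *)
Definition ev (x : char) (a : op) : bool :=
  if insub a is Some e then x e else false.

Definition Ehat0 : set char := [set x : char |
  [/\ exists e : E, x e,
      ~~ ev x (@op0 R _)
    & forall e f : E, ev x (val e \o val f) = x e && x f]].

Definition is_filter (A : set op) : Prop :=
  [/\ A !=set0,
      A `<=` E `\ @op0 R _,
      (forall e f, A e -> E f -> op_le e f -> A f)
    & (forall e f, A e -> A f -> A (e \o f))].

Definition is_ultrafilter (A : set op) : Prop :=
  is_filter A /\ forall A', is_filter A' -> A `<=` A' -> A' = A.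

Definition Ehat_inf : set char :=
  [set x | Ehat0 x /\ is_ultrafilter [set e | ev x e]].

(* closure relative to the subspace Ehat0 *)
Definition Ehat_tight : set char := Ehat0 `&` closure Ehat_inf.

(* N u {oo}, with None for oo *)
Definition nbar : Type := option nat.

Definition Lambda (k : nbar * nbar) : set op :=
  match k with
  | (Some k1, Some k2) => [set P4 (k1, k2)]
  | (Some k1, None) => [set P3 (k1, l) | l in [set l | (k1 <= l)%N]]
  | (None, Some k2) => [set P2 (l, k2) | l in [set l | (k2 <= l)%N]]
  | (None, None) => [set P1 (l, l) | l in [set: nat]]
  end.

Definition A_ (L : set op) : set op :=
  [set f | E f /\ exists2 e, L e & f \o e = e].

Definition phi (k : nbar * nbar) : char :=
  fun f : E => `[< A_ (Lambda k) (val f) >].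

Definition D (s : op) : set char := [set x | Ehat0 x /\ ev x (s \o adj s)].

Definition act (x : char) (s : op) : char :=
  fun e : E => ev x (s \o val e \o adj s).

Definition Sigma : set (char * op) := [set p | T p.2 /\ D p.2 p.1].

Definition germ_rel (p q : char * op) : Prop :=
  p.1 = q.1 /\ exists e, [/\ E e, ev p.1 e & e \o p.2 = e \o q.2].

(* [(x, s)], as the set of the elements of Sigma equivalent to (x, s) *)
Definition germ (x : char) (s : op) : set (char * op) :=
  [set q | Sigma q /\ germ_rel (x, s) q].

Definition arrow : Type := set (char * op).

(* graph of the partially defined product: ab = c *)
Definition germ_mul (a b c : arrow) : Prop :=
  exists x s s', [/\ Sigma (x, s), Sigma (act x s, s'),
    a = germ x s, b = germ (act x s) s' & c = germ x (s \o s')].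

(* graph of the inversion: a^-1 = b *)
Definition germ_inv (a b : arrow) : Prop :=
  exists x s, [/\ Sigma (x, s), a = germ x s & b = germ (act x s) (adj s)].

(* The reduction of {[(x, s)] : (x, s) in Sigma} to Ehat_tight: under
   [(x, 1)] <-> x, the range and the source of [(x, s)] are x and x . s. *)
Definition Gtight : set arrow := [set a | exists x s,
  [/\ Sigma (x, s), a = germ x s, Ehat_tight x & Ehat_tight (act x s)]].

(* {a a^-1 : a in G}, for a subgroupoid G of the groupoid of germs *)
Definition unit_space (G : set arrow) : set arrow :=
  [set c | exists a b, [/\ G a, germ_inv a b & germ_mul a b c]].

Definition unit_germ (x : char) : arrow := germ x idfun.

End InverseSemigroup.

Arguments T : clear implicits.
Arguments E : clear implicits.
Arguments Ehat0 : clear implicits.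
Arguments Ehat_inf : clear implicits.
Arguments Ehat_tight : clear implicits.
Arguments phi : clear implicits.
Arguments Gtight : clear implicits.
Arguments unit_germ : clear implicits.

(* Main.v *)
(** Every operator of T is the pullback of functions along a partial injection
    of the index set nat * nat * int of the canonical basis, and the adjoint is
    the pullback along the converse partial injection. The nonzero projections
    are thus the indicators of "boxes": products of two factors, each of which
    is a point {n} or a half line [n, oo[.

    Two boxes in a filter F meet. Let k_1 be a when F has a box with first
    factor {a}, and oo when there is none; define k_2 likewise. Every box in F
    then contains k, a half line being closed up with oo, so that F is a part of
    A_Lambda(k). These filters are maximal, hence they are the ultrafilters.

    A tight character x agrees with some phi(k') on all the boxes with end
    points at most N. If a box c * d around k as above is not in the filter of x,
    then, say, k'_1 is outside c while k_1 is not, so c = [n, oo[ and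
    k'_1 = j < n; but then x is 1 on a box with first factor {j}, against
    k_1 = oo. So Ehat_tight is already {phi(k)}.

    Finally, if (x, s) ~ (x, t) and (x s, s^* ) ~ (x t, t') are witnessed by e
    and f, then g = e (t f t^* ) = e (s f s^* ) satisfies x(g) = 1 and
    g t t' = g, so that a a^-1 is the germ of the identity at x. *)

Require Import Defs.
From mathcomp Require Import all_boot all_order all_algebra finmap zify.
From mathcomp Require Import all_classical all_reals all_analysis.
From mathcomp Require Import complex.
From mathcomp.analysis.showcase Require Import summability.

Set Implicit Arguments.
Unset Strict Implicit.
Unset Printing Implicit Defensive.

Import Order.TTheory GRing.Theory Num.Theory.
Import numFieldNormedType.Exports.

Local Open Scope classical_set_scope.
Local Open Scope ring_scope.

(** * Pullbacks along partial injections *)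

(** A map with a converse is injective where it is defined, so this encodes partial injections;
    swapping [s] and [t] will amount to taking adjoints. *)
Definition converse (X Y : Type) (s : X -> option Y) (t : Y -> option X) :=
  forall x y, s x = Some y <-> t y = Some x.

Lemma converse_sym (X Y : Type) (s : X -> option Y) (t : Y -> option X) :
  converse s t -> converse t s.
Proof. by move=> st x y; split=> /st. Qed.

Lemma converse_inj (X Y : Type) (s : X -> option Y) (t : Y -> option X) :
  converse s t -> forall x x' y, s x = Some y -> s x' = Some y -> x = x'.
Proof. by move=> st x x' y /st h /st; rewrite h => -[]. Qed.

Lemma converse_comp (X Y Z : Type) (s : X -> option Y) s'
    (t : Y -> option Z) t' :
  converse s s' -> converse t t' -> converse (obind t \o s) (obind s' \o t').
Proof.
move=> ss' tt' x z /=; split.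
  by case sx: (s x) => [y|//] /= /tt' -> /=; apply/ss'.
by case tz: (t' z) => [y|//] /= /ss' -> /=; apply/tt'.
Qed.

Section Pullback.
Context (R : realType).
Implicit Types X Y Z : choiceType.

Lemma ell2_ext X (f g : ell2 R X) : f =1 g -> f = g.
Proof. by move=> fg; apply: val_inj; apply: funext. Qed.

Lemma to_ell2K X (f : X -> R[i]) : square_summable f -> to_ell2 f =1 f.
Proof. by move=> hf x; rewrite -[LHS]/(val (to_ell2 f) x) insubdK. Qed.

(** Injectivity turns the sum over the domain of [s] into a sum over its image, which is dominated
    by the whole sum of nonnegative terms. *)
Lemma square_summable_pullback X Y (s : X -> option Y) (t : Y -> option X)
    (f : ell2 R Y) :
  converse s t -> square_summable (fun x => oapp f 0 (s x)).
Proof.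
move=> st; rewrite /square_summable.
set h := fun y => ((complex.Re (f y) ^+ 2 + complex.Im (f y) ^+ 2)%:E : \bar R).
have h0 y : (0 <= h y)%E by rewrite lee_fin addr_ge0 ?sqr_ge0.
have hfin : (\esum_(y in [set: Y]) h y < +oo)%E := coef_square_summable f.
(* Extending [s] to a total function takes a default value [y0]; if [s] is nowhere defined, all
   terms vanish. *)
have [[x0 [y0 _]]|no0] := pselect (exists x y, s x = Some y); last first.
  rewrite esum1 ?ltry// => x _ /=; case sx: (s x) => [y|] /=.
    by case: no0; exists x, y.
  by rewrite expr0n /= addr0.
pose e x := odflt y0 (s x); pose D := [set x | isSome (s x)].
have eI : set_inj D e.
  move=> x x'; rewrite !inE /D /e /=.
  case sx: (s x) => [y|//]; case sx': (s x') => [y'|//] _ _ /= yy'.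
  by apply: (converse_inj st sx); rewrite yy'.
apply: le_lt_trans hfin.
rewrite (_ : esum _ _ = (\esum_(x in D) h (e x))%E); last first.
  rewrite [RHS]esum_mkcond; apply: eq_esum => x _.
  rewrite /D /e mem_setE unfold_in /= /h; case: (s x) => [y|] //=.
  by rewrite expr0n /= addr0.
rewrite -(esum_image D e h eI) esum_mkcond.
by apply: le_esum => y _; case: ifP.
Qed.

Definition pullback X Y (s : X -> option Y) (f : ell2 R Y) : ell2 R X :=
  to_ell2 (fun x => oapp f 0 (s x)).

Lemma pullbackE X Y (s : X -> option Y) (t : Y -> option X) f :
  converse s t -> pullback s f =1 (fun x => oapp f 0 (s x)).
Proof. by move=> st; apply: to_ell2K; apply: square_summable_pullback st. Qed.

Lemma eq_pullback X Y (s s' : X -> option Y) :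
  s =1 s' -> pullback s = pullback s'.
Proof. by move=> /funext->. Qed.

Lemma pullback_comp X Y Z (s : X -> option Y) s' (t : Y -> option Z) t' :
  converse s s' -> converse t t' ->
  pullback s \o pullback t = pullback (obind t \o s).
Proof.
move=> ss' tt'; apply: funext => f; apply: ell2_ext => x.
rewrite /= (pullbackE _ ss') [RHS](pullbackE _ (converse_comp ss' tt')) /=.
by case: (s x) => //= y; rewrite (pullbackE _ tt').
Qed.

Definition basis_vector X (x : X) : ell2 R X :=
  to_ell2 (fun y => (y == x)%:R).

Lemma basis_vectorE X (x y : X) : basis_vector x y = (y == x)%:R.
Proof.
rewrite /basis_vector to_ell2K // /square_summable.
set h := (X in (esum _ X < _)%E).
rewrite (_ : esum _ _ = (\esum_(z in [set x]) h z)%E); last first.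
  rewrite [RHS]esum_mkcond; apply: eq_esum => z _.
  case: ifPn => [//|]; rewrite /h; case: (eqVneq z x) => [->|_ _] /=.
    by rewrite mem_set.
  by rewrite expr0n /= addr0.
by rewrite esum_set1 /h ?eqxx ?ltry // lee_fin addr_ge0 ?sqr_ge0.
Qed.

(** On the basis vector at [y], the pullback has coordinate 1 at [x] exactly when [s x] is [y]. *)
Lemma pullback_injective X Y (s s' : X -> option Y) t t' :
  converse s t -> converse s' t' -> pullback s = pullback s' -> s =1 s'.
Proof.
move=> st st' e x.
have E y : oapp (basis_vector y) 0 (s x) = oapp (basis_vector y) 0 (s' x).
  by rewrite -(pullbackE _ st) -(pullbackE _ st') e.
case sx: (s x) => [y|]; case sx': (s' x) => [y'|] //.
- have := E y; rewrite sx sx' /= !basis_vectorE eqxx.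
  by case: eqP => [->//|_] /eqP; rewrite oner_eq0.
- by have := E y; rewrite sx sx' /= !basis_vectorE eqxx => /eqP; rewrite oner_eq0.
- have := E y'; rewrite sx sx' /= !basis_vectorE eqxx => /esym/eqP.
  by rewrite oner_eq0.
Qed.

(** * Unconditional sums, inner products and adjoints *)

Lemma partial_sumE X (V : zmodType) (a : X -> V) (A : {fset X}) :
  partial_sum a A = \sum_(x <- A) a x.
Proof. by rewrite big_seq_fsetE. Qed.

Lemma sum_finite_support X (a : X -> (R[i])^o) (A : {fset X}) :
  (forall x, x \notin A -> a x = 0) ->
  summability.sum a = \sum_(x <- A) a x.
Proof.
move=> a0; have FF := @totally_filter X.
rewrite /summability.sum; apply: cvg_lim; first exact: norm_hausdorff.
apply: cvg_near_cst; exists A => // B /= AB.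
by rewrite partial_sumE [RHS](big_fset_incl _ AB) // => x _ /a0.
Qed.

Lemma inner_basis_vector X (x : X) (g : ell2 R X) :
  inner (basis_vector x) g = (g x)^*.
Proof.
rewrite /inner (@sum_finite_support _ _ [fset x]%fset) ?big_seq_fset1.
  by rewrite basis_vectorE eqxx mul1r.
by move=> y; rewrite inE basis_vectorE => /negPf->; rewrite mul0r.
Qed.

(** Pairing with basis vectors recovers every coordinate up to conjugation. As [adj] is obtained by
    choice, uniqueness is what lets it be computed. *)
Lemma is_adjoint_unique X (A B B' : operator R X) :
  is_adjoint A B -> is_adjoint A B' -> B = B'.
Proof.
move=> AB AB'; apply: funext => g; apply: ell2_ext => x.
apply: (can_inj (@conjCK _)).
by rewrite -!inner_basis_vector -AB -AB'.
Qed.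

(* The partial sums are compared directly, so that summability is not needed. *)
Lemma sum_reindex_sub X Y (s : X -> option Y) t
    (a : X -> (R[i])^o) (b : Y -> (R[i])^o) (l : (R[i])^o) :
  converse s t -> (forall x, a x = oapp b 0 (s x)) ->
  (forall y, b y = oapp a 0 (t y)) ->
  partial_sum a @ totally --> l -> partial_sum b @ totally --> l.
Proof.
move=> st ab ba al U /al [A _ hA].
exists [fset y in pmap s (enum_fset A)]%fset => // B /= AB.
(* [A'] adds to [A] the partners of points of [B], while [B] contains all partners of points of [A].
   The matched parts of [A'] and [B] thus correspond under [s], and unmatched terms are zero. *)
pose A' := (A `|` [fset x in pmap t (enum_fset B)])%fset.
have /hA : [set C | (A `<=` C)%fset] A' by rewrite /= fsubsetUl.
rewrite /=; congr U.
rewrite !partial_sumE /=.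
rewrite (bigID (fun x => s x : bool)) /= [X in _ + X]big1; last first.
  by move=> x; rewrite ab; case: (s x).
rewrite addr0 [RHS](bigID (fun y => t y : bool)) /= [X in _ = _ + X]big1; last first.
  by move=> y; rewrite ba; case: (t y).
rewrite addr0.
have pmapE : perm_eq [seq y <- enum_fset B | t y]
   (pmap s [seq x <- enum_fset A' | s x]).
  have uA' : uniq (pmap s [seq x <- enum_fset A' | s x]).
    have : uniq [seq x <- enum_fset A' | s x] by rewrite filter_uniq ?fset_uniq.
    elim: [seq _ <- _ | _] => //= x r IH /andP[xr ur].
    case sx: (s x) => [y|] /=; last exact: IH.
    rewrite IH // andbT; apply: contra xr; rewrite mem_pmap => /mapP[x' x'r].
    by move/esym => sx'; rewrite (converse_inj st sx sx').
  apply: uniq_perm => //; first by rewrite filter_uniq ?fset_uniq.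
  move=> y; rewrite mem_filter mem_pmap; apply/andP/mapP.
    case; case ty: (t y) => [x|//] _ yB; exists x; last by apply/esym/st.
    rewrite mem_filter (st x y).2 //= !inE; apply/orP; right.
    by rewrite mem_pmap; apply/mapP; exists y.
  case=> x; rewrite mem_filter => /andP[_ xA'] /esym sx.
  have ty := (st _ _).1 sx; rewrite ty; split=> //.
  move: xA'; rewrite !inE => /orP[xA|].
    apply: (fsubsetP AB); rewrite !inE mem_pmap; apply/mapP; exists x => //.
  by rewrite mem_pmap => /mapP[y' y'B /esym/st]; rewrite sx => -[->].
rewrite -[RHS]big_filter (perm_big _ pmapE) /= -[LHS]big_filter.
elim: [seq _ <- _ | _] => [|x r IH]; first by rewrite !big_nil.
rewrite big_cons /= ab; case: (s x) => [y|] /=; last by rewrite add0r.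
by rewrite big_cons IH.
Qed.

Lemma sum_reindex X Y (s : X -> option Y) t
    (a : X -> (R[i])^o) (b : Y -> (R[i])^o) :
  converse s t -> (forall x, a x = oapp b 0 (s x)) ->
  (forall y, b y = oapp a 0 (t y)) ->
  summability.sum a = summability.sum b.
Proof.
move=> st ab ba; rewrite /summability.sum /lim.
(* Both nets have the same set of limits, hence the same chosen limit, even if that set is empty. *)
congr (get _); apply/seteqP; split=> l /=.
  exact: sum_reindex_sub st ab ba.
exact: sum_reindex_sub (converse_sym st) ba ab.
Qed.

Lemma inner_pullback X Y (s : X -> option Y) (t : Y -> option X) f g :
  converse s t -> inner (pullback s f) g = inner f (pullback t g).
Proof.
move=> st; apply: (sum_reindex st).
  move=> x; rewrite (pullbackE _ st); case sx: (s x) => [y|] /=.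
    by rewrite (pullbackE _ (converse_sym st)) ((st _ _).1 sx).
  by rewrite mul0r.
move=> y; rewrite (pullbackE _ (converse_sym st)); case ty: (t y) => [x|] /=.
  by rewrite (pullbackE _ st) ((st _ _).2 ty).
by rewrite conjC0 mulr0.
Qed.

Lemma adj_pullback X (s t : X -> option X) :
  converse s t -> adj (pullback s) = pullback t.
Proof.
move=> st; rewrite /adj.
have h : is_adjoint (pullback s) (pullback t).
  by move=> f g; apply: inner_pullback.
by apply: xget_unique => // B hB; apply: is_adjoint_unique hB h.
Qed.

(** * Tensor products *)

Definition tensor_map (X X' Y Y' : Type) (s : X -> option X')
    (t : Y -> option Y') (p : X * Y) : option (X' * Y') :=
  obind (fun x => omap (pair x) (t p.2)) (s p.1).

Lemma converse_tensor_map (X X' Y Y' : Type) (s : X -> option X') s'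
    (t : Y -> option Y') t' :
  converse s s' -> converse t t' ->
  converse (tensor_map s t) (tensor_map s' t').
Proof.
move=> ss' tt' [x y] [x' y']; rewrite /tensor_map /=; split.
  case sx: (s x) => [u|//] /=; case ty: (t y) => [v|//] /= [<- <-].
  by rewrite ((ss' _ _).1 sx) ((tt' _ _).1 ty).
case sx: (s' x') => [u|//] /=; case ty: (t' y') => [v|//] /= [<- <-].
by rewrite ((ss' _ _).2 sx) ((tt' _ _).2 ty).
Qed.

(** The coefficients agree pointwise once no [to_ell2] falls back on its default: every family it
    receives is a pullback of [f] along a partial injection. *)
Lemma tensor_pullback X Y (s s' : X -> option X) (t t' : Y -> option Y) :
  converse s s' -> converse t t' ->
  pullback s ⊗ pullback t = pullback (tensor_map s t).
Proof.
move=> ss' tt'; apply: funext => f; apply: ell2_ext => p.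
rewrite [RHS](pullbackE _ (converse_tensor_map ss' tt')) /tensor.
have fE x : to_ell2 (fun y => f (x, y)) =1 (fun y => f (x, y)).
  apply: to_ell2K.
  apply: (@square_summable_pullback _ _ (fun y => Some (x, y))
           (fun q : X * Y => if q.1 == x then Some q.2 else None)).
  move=> y [x' y'] /=; split; first by case=> -> ->; rewrite eqxx.
  by case: eqP => // -> [->].
have gE q : to_ell2 (fun x => pullback t (to_ell2 (fun y => f (x, y))) q) =1
            (fun x => oapp (fun y => f (x, y)) 0 (t q)).
  move=> x; rewrite to_ell2K.
    by rewrite (pullbackE _ tt'); case: (t q) => //= y; rewrite fE.
  rewrite (_ : (fun x => _) =
               (fun x => oapp f 0 (omap (pair x) (t q)))); last first.
    apply: funext => x'; rewrite (pullbackE _ tt').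
    by case: (t q) => //= y; rewrite fE.
  apply: (@square_summable_pullback _ _ _
           (fun q' : X * Y => if t q == Some q'.2 then Some q'.1 else None)).
  move=> x' [x'' y] /=; case tq: (t q) => [y'|] /=; last by split.
  by split=> [[-> ->]|]; [rewrite eqxx|case: eqP => // -[->] [->]].
rewrite to_ell2K => [|].
  rewrite (pullbackE _ ss') /tensor_map; case: (s p.1) => //= x.
  by rewrite gE; case: (t p.2).
rewrite (_ : (fun p => _) = (fun p => oapp f 0 (tensor_map s t p))).
  exact: square_summable_pullback (converse_tensor_map ss' tt').
apply: funext => q; rewrite (pullbackE _ ss') /tensor_map.
by case: (s q.1) => //= x; rewrite gE; case: (t q.2).
Qed.

End Pullback.

(** * Generators and projections *)

(* (n, true) stands for the half line [n, oo[ and (n, false) for the point n. *)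
Definition ray : Type := (nat * bool)%type.

Definition in_ray (c : ray) (k : nat) : bool :=
  if c.2 then (c.1 <= k)%N else k == c.1.

(** The bijection from the ray at [n] to the ray at [m]; the flags [true] and [false] yield
    $S^{*n}S^m$ and $S^{*n}pS^m$. *)
Definition ray_map (b : bool) (n m k : nat) : option nat :=
  if in_ray (n, b) k then Some (k - n + m)%N else None.

Lemma converse_ray_map b n m :
  converse (ray_map b n m) (ray_map b m n).
Proof.
by move=> x y; rewrite /ray_map /in_ray /=; case: b; split;
  case: ifP => // h [<-]; case: ifP => h'; try (congr Some); lia.
Qed.

Definition translate (r z : int) : option int := Some (z + r).

Lemma converse_translate r : converse (translate r) (translate (- r)).
Proof.
by move=> x y; split=> -[<-]; rewrite /translate ?addrK ?subrK.
Qed.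

Section Generators.
Context (R : realType).

Lemma iter_pullback (X : choiceType) (s t : X -> option X) n :
  converse s t ->
  iter n (pullback (R := R) s) = pullback (iter n (obind s) \o Some)
  /\ converse (iter n (obind s) \o Some) (iter n (obind t) \o Some).
Proof.
(* Composing pullbacks applies the new copy of [s] first, whereas [iter] applies it last; peeling
   off the innermost step reconciles the two. *)
move=> st; have iterSr' u k (x : X) : iter k.+1 (obind u) (Some x) =
    obind (iter k (obind u) \o Some) (u x).
  rewrite iterSr /=; case: (u x) => //=.
  by elim: k => //= k ->.
elim: n => [|n [IHn IHc]].
  split; last by move=> x y /=; split=> -[->].
  apply: funext => f; apply: ell2_ext => x.
  by rewrite (@pullbackE _ _ _ (Some) Some) // => ? ?; split=> -[->].
have cS : converse (iter n.+1 (obind s) \o Some) (iter n.+1 (obind t) \o Some).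
  move=> x z; rewrite [X in X = _ <-> _]iterSr' [X in _ <-> X = _]/=; split.
    case sx: (s x) => [y|//] /= /IHc /= ->; exact/st.
  case tz: (iter n _ _) => [y|//] /= /st -> /=; exact/IHc.
split=> //; apply: funext => f /=.
have -> : iter n (pullback s) f = pullback (iter n (obind s) \o Some) f.
  by rewrite -IHn.
rewrite -[LHS]/((pullback s \o pullback _) f) (pullback_comp _ st IHc).
by congr (pullback _ f); apply: funext => x; rewrite [RHS]iterSr'.
Qed.

Definition predn_opt (n : nat) : option nat :=
  if n is n'.+1 then Some n' else None.

Lemma converse_succ : converse (fun n => Some n.+1) predn_opt.
Proof. by move=> x [|y]; split=> //= -[->]. Qed.

Lemma shiftE : @Defs.shift R = pullback (fun n => Some n.+1).
Proof. by []. Qed.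

Lemma adj_shiftE : adj (@Defs.shift R) = pullback predn_opt.
Proof. by rewrite shiftE; apply: adj_pullback converse_succ. Qed.

Lemma proj0E : @proj0 R = pullback (ray_map false 0 0).
Proof.
apply: funext => f; congr to_ell2; apply: funext => n.
by rewrite /ray_map /in_ray /=; case: eqP => [->|].
Qed.

Lemma iter_succ n k : iter n (obind (fun n => Some n.+1)) (Some k) = Some (k + n)%N.
Proof. by elim: n => [|n IH] /=; rewrite ?IH /= ?addn0 ?addnS. Qed.

Lemma iter_predn n k : iter n (obind predn_opt) (Some k) =
  if (n <= k)%N then Some (k - n)%N else None.
Proof.
elim: n => [|n IH] /=; rewrite ?IH ?subn0 //.
have [nk|kn] := ltnP n k; first by rewrite (ltnW nk) /= -(subnSK nk).
by case: ifP => //= nk; rewrite (_ : k - n = 0)%N //; lia.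
Qed.

Lemma SSE n m : @SS R n m = pullback (ray_map true n m).
Proof.
rewrite /SS adj_shiftE shiftE.
have [-> cs] := iter_pullback m converse_succ.
have [-> cp] := iter_pullback n (converse_sym converse_succ).
rewrite (pullback_comp _ cp cs); apply: eq_pullback => k /=.
by rewrite iter_predn /ray_map /in_ray /=; case: ifP => //= _; rewrite iter_succ.
Qed.

Lemma SpSE n m : @SpS R n m = pullback (ray_map false n m).
Proof.
rewrite /SpS adj_shiftE shiftE proj0E.
have [-> cs] := iter_pullback m converse_succ.
have [-> cp] := iter_pullback n (converse_sym converse_succ).
have c0 := @converse_ray_map false 0 0.
rewrite (pullback_comp _ cp c0) (pullback_comp _ (converse_comp cp c0) cs).
apply: eq_pullback => k /=; rewrite iter_predn /ray_map /in_ray /=.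
have [nk|kn] := leqP n k => /=; last by case: eqP => //; lia.
have -> : (k == n) = (k - n == 0)%N by lia.
by case: eqP => //= ->; rewrite iter_succ.
Qed.

Lemma bishiftE : @bishift R = pullback (translate 1).
Proof. by []. Qed.

Lemma iter_translate a n z :
  iter n (obind (translate a)) (Some z) = Some (z + a *+ n).
Proof.
by elim: n => [|n IH] /=; rewrite ?IH /= ?addr0 // mulrS [a + _]addrC addrA.
Qed.

Lemma bishift_powE r : @bishift_pow R r = pullback (translate r).
Proof.
case: r => n; rewrite /bishift_pow bishiftE.
  have [-> _] := iter_pullback n (@converse_translate 1).
  by apply: eq_pullback => z /=; rewrite iter_translate -natz.
rewrite (adj_pullback R (@converse_translate 1)).
have [-> _] := iter_pullback n.+1 (converse_sym (@converse_translate 1)).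
apply: eq_pullback => z; rewrite /comp iter_translate /translate NegzE -natz.
by rewrite mulNrn.
Qed.

Definition box_map b1 b2 (r : int) (n m : nat * nat) :
    (nat * nat * int -> option (nat * nat * int))%type :=
  tensor_map (tensor_map (ray_map b1 n.1 m.1) (ray_map b2 n.2 m.2))
    (translate r).

Lemma converse_box_map b1 b2 r n m :
  converse (box_map b1 b2 r n m) (box_map b1 b2 (- r) m n).
Proof.
by do !apply: converse_tensor_map;
  [exact: converse_ray_map|exact: converse_ray_map|exact: converse_translate].
Qed.

Lemma tensor3 b1 b2 r n m :
  pullback (ray_map b1 n.1 m.1) ⊗ pullback (ray_map b2 n.2 m.2)
    ⊗ pullback (translate r) = pullback (R := R) (box_map b1 b2 r n m).
Proof.
have c := converse_ray_map.
rewrite (tensor_pullback _ (c b1 n.1 m.1) (c b2 n.2 m.2)).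
by rewrite (tensor_pullback _ (converse_tensor_map (c _ _ _) (c _ _ _)) (@converse_translate r)).
Qed.

(* The constraint on n_1 and n_2 in B_i; i is 1, 2, 3, 4 when the flags of c and
   d are (true, true), (true, false), (false, true), (false, false). *)
Definition valid (c d : ray) : bool :=
  (c.2 ==> (d.1 <= c.1)%N) && (d.2 ==> (c.1 <= d.1)%N).

(** One normal form for the four families, their index being encoded by two flags, spares later case
    distinctions. *)
Lemma T_elim (a : op R) : T R a -> a = @op0 R _ \/
  exists b1 b2 r n m, [/\ valid (n.1, b1) (n.2, b2), valid (m.1, b1) (m.2, b2) &
    a = pullback (box_map b1 b2 r n m)].
Proof.
case=> [|r n m nn mm _|r n m _ nn mm|r n m _ nn mm|r n m]; [by left|right..];
  rewrite /B1 /B2 /B3 /B4 ?SSE ?SpSE bishift_powE.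
- exists true, true, r, n, m; rewrite -(tensor3 true true r n m) /valid /=.
  by rewrite -nn -mm !leqnn.
- by exists true, false, r, n, m; rewrite -(tensor3 true false r n m) /valid /= !andbT.
- by exists false, true, r, n, m; rewrite -(tensor3 false true r n m) /valid /=.
- by exists false, false, r, n, m; rewrite -(tensor3 false false r n m).
Qed.

Lemma box_T b1 b2 n : valid (n.1, b1) (n.2, b2) ->
  T R (pullback (box_map b1 b2 0 n n)).
Proof.
rewrite -(tensor3 b1 b2 0 n n) -bishift_powE.
case: b1; case: b2; rewrite -?SSE -?SpSE /valid /=.
- move=> /andP[h1 h2]; have e : n.1 = n.2 by lia.
  by rewrite -e; exact: (@T_B1 R 0 n n e e (esym (subrr _))).
- by rewrite andbT => h; exact: (@T_B2 R 0 n n (esym (subrr _)) h h).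
- by move=> h; exact: (@T_B3 R 0 n n (esym (subrr _)) h h).
- by move=> _; exact: (@T_B4 R 0 n n).
Qed.

(** * Diagonal projections and boxes *)

Lemma op0E (X : choiceType) : @op0 R X = pullback (fun _ => None).
Proof.
by apply: funext => f; apply: ell2_ext => x; rewrite (@pullbackE _ _ _ _ (fun _ => None)).
Qed.

(** Multiplication by the indicator of [Q]; products of such operators become intersections. *)
Definition restrict (X : choiceType) (Q : pred X) : operator R X :=
  pullback (fun x => if Q x then Some x else None).

Lemma converse_restrict (X : Type) (Q : pred X) :
  let s x := if Q x then Some x else None in converse s s.
Proof. by move=> s x y; split; rewrite /s; case: ifP => // Qx [<-]; rewrite Qx. Qed.

Lemma restrict_comp (X : choiceType) (Q Q' : pred X) :
  restrict Q \o restrict Q' = restrict (predI Q Q').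
Proof.
rewrite /restrict (pullback_comp _ (converse_restrict Q) (converse_restrict Q')).
by apply: eq_pullback => x /=; case: (Q x).
Qed.

Lemma restrict_injective (X : choiceType) (Q Q' : pred X) :
  restrict Q = restrict Q' -> Q =1 Q'.
Proof.
move=> /(pullback_injective (converse_restrict Q) (converse_restrict Q')) h x.
by have := h x; case: (Q x); case: (Q' x).
Qed.

Lemma eq_restrict (X : choiceType) (Q Q' : pred X) :
  Q =1 Q' -> restrict Q = restrict Q'.
Proof. by move=> h; apply: eq_pullback => x; rewrite h. Qed.

Lemma restrict_adj (X : choiceType) (Q : pred X) : adj (restrict Q) = restrict Q.
Proof. exact: adj_pullback (converse_restrict Q). Qed.

Lemma restrict0 (X : choiceType) : @restrict X pred0 = @op0 R X.
Proof. by rewrite op0E. Qed.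

Definition in_box (c d : ray) (p : nat * nat * int) : bool :=
  in_ray c p.1.1 && in_ray d p.1.2.

Definition box (c d : ray) : op R := restrict (in_box c d).

Lemma box_mapE (c d : ray) :
  pullback (box_map c.2 d.2 0 (c.1, d.1) (c.1, d.1)) = box c d.
Proof.
apply: eq_pullback => -[[x y] z]; rewrite /box_map /tensor_map /ray_map /in_box /=.
rewrite -!surjective_pairing.
case: ifP => //= hy; case: ifP => //= hx; rewrite addr0; congr (Some (_, _, _)).
  by move: hx; rewrite /in_ray; case: ifP; lia.
by move: hy; rewrite /in_ray; case: ifP; lia.
Qed.

Lemma box_E c d : valid c d -> E R (box c d).
Proof.
move=> v; split; last exact: restrict_adj.
  by rewrite -box_mapE; apply: box_T; rewrite /= -!surjective_pairing.
by rewrite /box restrict_comp; apply: eq_restrict => p /=; rewrite andbb.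
Qed.

Lemma op0_E : E R (@op0 R _).
Proof.
split; first exact: T_0.
  by rewrite -restrict0 restrict_comp; apply: eq_restrict.
by rewrite -restrict0 restrict_adj.
Qed.

(** The corner [(n.1, n.2, 0)] of the domain is sent to [(m.1, m.2, r)], which idempotence makes a
    fixed point; injectivity then gives [n = m] and [r = 0]. *)
Lemma E_elim (a : op R) : E R a ->
  a = @op0 R _ \/ exists c d, valid c d /\ a = box c d.
Proof.
case=> /T_elim[->|[b1 [b2 [r [n [m [vn vm ->]]]]]]]; first by left.
have cb := @converse_box_map b1 b2 r n m.
rewrite (pullback_comp _ cb cb) (adj_pullback R cb) => h1 h2.
right; exists (n.1, b1), (n.2, b2); split=> //.
have {}h1 := pullback_injective (converse_comp cb cb) cb h1.
have {}h2 := pullback_injective (converse_sym cb) cb h2.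
have e : box_map b1 b2 r n m (n.1, n.2, 0) = Some (m.1, m.2, r).
  rewrite /box_map /tensor_map /ray_map /in_ray /= !eqxx !leqnn !if_same /=.
  by rewrite !subnn !add0n add0r.
have : box_map b1 b2 r n m (m.1, m.2, r) = Some (m.1, m.2, r).
  by have := h1 (n.1, n.2, 0); rewrite /= e.
move=> e2; have [e3 e4 e5] := converse_inj cb e2 e.
rewrite -(box_mapE (n.1, b1) (n.2, b2)) /= -surjective_pairing e5.
by rewrite (surjective_pairing m) e3 e4 -surjective_pairing.
Qed.

End Generators.

(** * Intersections and closures of rays *)

Definition meet (c c' : ray) : ray := (maxn c.1 c'.1, c.2 && c'.2).

(** Rays with a common point share the larger of their end points, so this single test decides
    whether [meet] is their intersection. *)
Definition meets (c c' : ray) : bool :=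
  in_ray c (maxn c.1 c'.1) && in_ray c' (maxn c.1 c'.1).

(* Membership of k in the closure of c in nbar. *)
Definition in_lim (c : ray) (k : nbar) : bool :=
  if k is Some a then in_ray c a else c.2.

Ltac ray_lia :=
  rewrite /meet /meets /valid /in_lim /in_ray /=;
  repeat match goal with c : ray |- _ => destruct c as [? []] end;
  simpl in *; lia.

Lemma in_meet c c' k : meets c c' ->
  in_ray c k && in_ray c' k = in_ray (meet c c') k.
Proof. ray_lia. Qed.

Lemma not_meets c c' k : ~~ meets c c' -> in_ray c k && in_ray c' k = false.
Proof. ray_lia. Qed.

Lemma valid_meet c d c' d' : valid c d -> valid c' d' -> meets c c' ->
  meets d d' -> valid (meet c c') (meet d d').
Proof. ray_lia. Qed.

Lemma in_lim_meet c c' k : meets c c' ->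
  in_lim (meet c c') k = in_lim c k && in_lim c' k.
Proof. by move=> m; case: k => [a|//] /=; rewrite in_meet. Qed.

Lemma not_meets_lim c c' k : ~~ meets c c' -> in_lim c k && in_lim c' k = false.
Proof. by case: k => [a /not_meets->//|] /=; ray_lia. Qed.

(** As [l] grows, a neighbourhood basis at [k]: the point itself if [k] is finite, tails if it is
    infinite. *)
Definition lam (k : nbar) (l : nat) : ray :=
  if k is Some a then (a, false) else (l, true).

Lemma lam_sub k l c : (forall x, in_ray (lam k l) x -> in_ray c x) ->
  in_lim c k.
Proof.
case: k => [a|] /= h; first by apply: h; rewrite /in_ray /=.
(* A point of the tail beyond the end point of [c]: only a half line contains it. *)
by have := h (l + c.1).+1; ray_lia.
Qed.

Lemma sub_lam k l c x : in_lim c k -> (c.1 <= l)%N -> in_ray (lam k l) x ->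
  in_ray c x.
Proof. by case: k => [a|] /=; ray_lia. Qed.

(** The bound is strict because, for infinite [k], [c] is a single point that the tail from [l] has
    to miss. *)
Lemma lam_disjoint k l c x : ~~ in_lim c k -> (c.1 < l)%N ->
  in_ray (lam k l) x -> in_ray c x = false.
Proof. by case: k => [a|] /=; ray_lia. Qed.

(** * The semilattice of projections *)

Section Semilattice.
Context (R : realType).
Local Notation box := (@box R).

Lemma box_comp c d c' d' : box c d \o box c' d' =
  if meets c c' && meets d d' then box (meet c c') (meet d d') else @op0 R _.
Proof.
rewrite restrict_comp; case: ifPn => [/andP[m m']|]; last rewrite negb_and => h.
  by apply: eq_restrict => p; rewrite /in_box /= -!in_meet // andbACA.
rewrite -restrict0; apply: eq_restrict => p; rewrite /in_box /= andbACA.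
by case/orP: h => /not_meets-> //; rewrite andbF.
Qed.

Lemma box_neq0 c d : box c d <> @op0 R _.
Proof.
rewrite -restrict0 => /restrict_injective/(_ (c.1, d.1, 0)).
by rewrite /in_box /in_ray /= eqxx leqnn if_same eqxx leqnn if_same.
Qed.

(** Boxes are nonempty, so an inclusion can be tested on one factor with the other coordinate held
    at an end point. *)
Lemma box_le c d c' d' : box c d \o box c' d' = box c' d' <->
  (forall x, in_ray c' x -> in_ray c x) /\
  (forall y, in_ray d' y -> in_ray d y).
Proof.
split; last first.
  case=> hc hd; rewrite restrict_comp; apply: eq_restrict => -[[x y] z] /=.
  rewrite /in_box /=; apply: andb_idl => /andP[/hc-> /hd->] //.
have in0 c0 : in_ray c0 c0.1 by rewrite /in_ray eqxx leqnn if_same.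
rewrite restrict_comp => /restrict_injective h; split=> x hx.
  have := h (x, d'.1, 0); rewrite /= /in_box /= hx in0.
  by case: (in_ray c x).
have := h (c'.1, x, 0); rewrite /= /in_box /= hx in0.
by case: (in_ray d x); rewrite ?andbF.
Qed.

Lemma comp_op0 (e : op R) : E R e -> e \o @op0 R _ = @op0 R _.
Proof.
case/E_elim => [->//|[c [d [_ ->]]]].
by rewrite -restrict0 restrict_comp; apply: eq_restrict => p; rewrite /= andbF.
Qed.

Lemma E_comp (e f : op R) : E R e -> E R f -> E R (e \o f).
Proof.
move=> Ee Ef; case/E_elim: (Ee) => [->|[c [d [v ->]]]]; first exact: op0_E.
case/E_elim: (Ef) => [->|[c' [d' [v' ->]]]].
  by rewrite comp_op0; [exact: op0_E|exact: box_E].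
rewrite box_comp; case: ifP => [/andP[m m']|_]; last exact: op0_E.
exact/box_E/valid_meet.
Qed.

Lemma E_restrict (e : op R) : E R e -> exists Q, e = restrict Q.
Proof.
case/E_elim => [->|[c [d [_ ->]]]]; last by exists (in_box c d).
by exists pred0; rewrite restrict0.
Qed.

Lemma restrictC (X : choiceType) (Q Q' : pred X) :
  restrict (R := R) Q \o restrict Q' = restrict Q' \o restrict Q.
Proof. by rewrite !restrict_comp; apply: eq_restrict => x /=; rewrite andbC. Qed.

Lemma E_comm (e f : op R) : E R e -> E R f -> e \o f = f \o e.
Proof. by move=> /E_restrict[Q ->] /E_restrict[Q' ->]; exact: restrictC. Qed.

Lemma idE : idfun = box (0%N, true) (0%N, true).
Proof.
apply: funext => f; apply: ell2_ext => x.
by rewrite [RHS](pullbackE f (converse_restrict (in_box (0%N, true) (0%N, true)))).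
Qed.

Lemma id_E : E R idfun.
Proof. by rewrite idE; apply: box_E. Qed.

(** * Adjoint identities in [T] *)

Lemma T_pullback (t : op R) : T R t -> exists s s', converse s s' /\ t = pullback s.
Proof.
case/T_elim => [->|[b1 [b2 [r [n [m [_ _ ->]]]]]]].
  by exists (fun=> None), (fun=> None); rewrite op0E.
by exists (box_map b1 b2 r n m), (box_map b1 b2 (- r) m n); split=> //;
   exact: converse_box_map.
Qed.

Lemma T_adjK (t : op R) : T R t -> t \o adj t \o t = t.
Proof.
case/T_pullback => s [s' [ss' ->]]; have s's := converse_sym ss'.
rewrite (adj_pullback R ss') (pullback_comp R ss' s's).
rewrite (pullback_comp R (converse_comp ss' s's) ss').
apply: eq_pullback => x /=; case sx: (s x) => [y|//] /=.
by rewrite ((ss' _ _).1 sx) /= sx.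
Qed.

Lemma T_adj_comp_restrict (t : op R) : T R t -> exists Q, adj t \o t = restrict Q.
Proof.
case/T_pullback => s [s' [ss' ->]]; have s's := converse_sym ss'.
rewrite (adj_pullback R ss') (pullback_comp R s's ss').
exists (fun y => s' y : bool); apply: eq_pullback => y /=.
by case sy: (s' y) => [x|//] /=; apply/ss'.
Qed.

Lemma adj_comp_E (e t : op R) : E R e -> T R t -> adj (e \o t) = adj t \o e.
Proof.
move=> /E_restrict[Q ->] /T_pullback[s [s' [ss' ->]]].
have cQ := converse_restrict Q.
rewrite (pullback_comp R cQ ss') (adj_pullback R ss').
rewrite (adj_pullback R (converse_comp cQ ss')).
by rewrite (pullback_comp R (converse_sym ss') cQ).
Qed.

(** * The filters $A_{\Lambda(k)}$ *)

Lemma P1E n1 n2 : n1 = n2 -> @P1 R (n1, n2) = box (n1, true) (n2, true).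
Proof.
move=> <-; rewrite /P1 /B1 !SSE bishift_powE.
by rewrite -(box_mapE _ (n1, true) (n1, true)) -(tensor3 _ true true).
Qed.

Lemma P2E n1 n2 : @P2 R (n1, n2) = box (n1, true) (n2, false).
Proof.
rewrite /P2 /B2 SSE SpSE bishift_powE.
by rewrite -(box_mapE _ (n1, true) (n2, false)) -(tensor3 _ true false).
Qed.

Lemma P3E n1 n2 : @P3 R (n1, n2) = box (n1, false) (n2, true).
Proof.
rewrite /P3 /B3 SSE SpSE bishift_powE.
by rewrite -(box_mapE _ (n1, false) (n2, true)) -(tensor3 _ false true).
Qed.

Lemma P4E n1 n2 : @P4 R (n1, n2) = box (n1, false) (n2, false).
Proof.
rewrite /P4 /B4 !SpSE bishift_powE.
by rewrite -(box_mapE _ (n1, false) (n2, false)) -(tensor3 _ false false).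
Qed.

(** Treats the four cases of [Lambda] at once. The default 0 puts no bound on [l] for an infinite
    coordinate; if both are finite, every admissible [l] gives the same box. *)
Lemma LambdaE k : @Lambda R k = [set box (lam k.1 l) (lam k.2 l) |
  l in [set l | (odflt 0%N k.1 <= l)%N /\ (odflt 0%N k.2 <= l)%N]].
Proof.
apply/seteqP; case: k => -[a|] [b|] /=; split => e /=.
- by move=> ->; exists (maxn a b); [split; lia|rewrite P4E].
- by case=> l _ <-; rewrite P4E.
- by case=> l al <-; exists l; [split; lia|rewrite P3E].
- by case=> l [al _] <-; exists l => //; rewrite P3E.
- by case=> l al <-; exists l; [split; lia|rewrite P2E].
- by case=> l [_ bl] <-; exists l => //; rewrite P2E.
- by case=> l _ <-; exists l => //; rewrite P1E.
- by case=> l _ <-; exists l => //; rewrite P1E.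
Qed.

(** The boxes of [Lambda k] shrink to [k], so a box contains one of them exactly when its closure
    contains [k]. *)
Lemma A_Lambda_box k c d : valid c d ->
  A_ (@Lambda R k) (box c d) <-> in_lim c k.1 && in_lim d k.2.
Proof.
move=> v; rewrite LambdaE; split.
  by case=> _ [_ [l _ <-]] /box_le[/lam_sub-> /lam_sub->].
case/andP=> hc hd; split; first exact: box_E.
(* Large enough to be admissible in [Lambda k] and to reach both end points of the box. *)
pose l := (c.1 + d.1 + odflt 0 k.1 + odflt 0 k.2)%N.
exists (box (lam k.1 l) (lam k.2 l)); first by exists l => //; split; lia.
by apply/box_le; split=> x; apply: sub_lam => //; lia.
Qed.

Lemma A_Lambda0 k : ~ A_ (@Lambda R k) (@op0 R _).
Proof. by rewrite LambdaE => -[_ [_ [l _ <-]]] /esym/box_neq0. Qed.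

(** Closing up rays commutes with intersecting them. This yields both the filter axioms and the
    multiplicativity of [phi]. *)
Lemma A_Lambda_comp k (e f : op R) : E R e -> E R f ->
  A_ (@Lambda R k) (e \o f) <-> A_ (@Lambda R k) e /\ A_ (@Lambda R k) f.
Proof.
move=> Ee Ef; case/E_elim: (Ee) => [->|[c [d [v ->]]]].
  by split=> [/A_Lambda0//|[/A_Lambda0]].
case/E_elim: (Ef) => [->|[c' [d' [v' ->]]]].
  rewrite comp_op0; last exact: box_E.
  by split=> [/A_Lambda0//|[_ /A_Lambda0]].
rewrite (A_Lambda_box k v) (A_Lambda_box k v') box_comp.
rewrite (_ : (_ /\ _) <-> (in_lim c k.1 && in_lim c' k.1) &&
                         (in_lim d k.2 && in_lim d' k.2)); last first.
  by rewrite andbACA; split=> [[-> ->]|/andP[]].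
case: ifPn => [/andP[m m']|]; last first.
  rewrite negb_and; case/orP=> /not_meets_lim-> //; rewrite ?andbF.
    by split=> // /A_Lambda0.
  by split=> // /A_Lambda0.
by rewrite A_Lambda_box ?valid_meet // !in_lim_meet.
Qed.

Lemma A_Lambda_id k : A_ (@Lambda R k) idfun.
Proof. by rewrite idE; apply/A_Lambda_box => //; case: k => -[a|] [b|]. Qed.

Lemma A_Lambda_filter k : is_filter (A_ (@Lambda R k)).
Proof.
split; first by exists idfun; exact: A_Lambda_id.
- by move=> e Ae; split=> [|e0]; [case: Ae|move: Ae; rewrite /= e0 => /A_Lambda0].
- move=> e f Ae Ef; rewrite /op_le => fe.
  have Ee : E R e by case: Ae.
  by move: Ae; rewrite -{1}fe => /(A_Lambda_comp k Ef Ee)[].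
- move=> e f Ae Af; apply/A_Lambda_comp => //; by [case: Ae|case: Af].
Qed.

(** * Locating an arbitrary filter *)

Section Filters.
Context (F : set (op R)) (filterF : is_filter F).

Lemma filter_meets c d c' d' : F (box c d) -> F (box c' d') ->
  meets c c' && meets d d'.
Proof.
case: filterF => _ F0 _ Fm h h'; have /F0[_] := Fm _ _ h h'.
by rewrite box_comp; case: ifP => // _ [].
Qed.

(** The last two clauses keep the evidence for the choice of [k]: a witness in [F] for a finite
    coordinate, the absence of point factors for an infinite one. The description of tight
    characters relies on both. *)
Lemma filter_boxes : exists k : nbar * nbar,
  [/\ forall c d, valid c d -> F (box c d) -> in_lim c k.1 && in_lim d k.2,
      if k.1 is Some a then exists2 d, valid (a, false) d & F (box (a, false) d)
      else forall a d, valid (a, false) d -> ~ F (box (a, false) d)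
    & if k.2 is Some b then exists2 c, valid c (b, false) & F (box c (b, false))
      else forall b c, valid c (b, false) -> ~ F (box c (b, false))].
Proof.
have [k1 [h1 w1]] : exists k1,
    (forall c d, valid c d -> F (box c d) -> in_lim c k1) /\
    if k1 is Some a then exists2 d, valid (a, false) d & F (box (a, false) d)
    else forall a d, valid (a, false) d -> ~ F (box (a, false) d).
  have [[a [d v ad]]|no] :=
      pselect (exists a, exists2 d, valid (a, false) d & F (box (a, false) d)).
    exists (Some a); split=> [c d' _ cd'|]; last by exists d.
    by case/andP: (filter_meets ad cd'); ray_lia.
  have {}no a d : valid (a, false) d -> ~ F (box (a, false) d).
    by move=> v h; apply: no; exists a, d.
  by exists None; split=> // -[n []] // d /no.
have [k2 [h2 w2]] : exists k2,
    (forall c d, valid c d -> F (box c d) -> in_lim d k2) /\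
    if k2 is Some b then exists2 c, valid c (b, false) & F (box c (b, false))
    else forall b c, valid c (b, false) -> ~ F (box c (b, false)).
  have [[b [c v bc]]|no] :=
      pselect (exists b, exists2 c, valid c (b, false) & F (box c (b, false))).
    exists (Some b); split=> [c' d' _ cd'|]; last by exists c.
    by case/andP: (filter_meets bc cd') => _; ray_lia.
  have {}no b c : valid c (b, false) -> ~ F (box c (b, false)).
    by move=> v h; apply: no; exists b, c.
  by exists None; split=> // c [n []] // /no.
by exists (k1, k2); split=> // c d v cd; rewrite (h1 c d) // (h2 c d).
Qed.

Lemma filter_sub_A k :
  (forall c d, valid c d -> F (box c d) -> in_lim c k.1 && in_lim d k.2) ->
  F `<=` A_ (@Lambda R k).
Proof.
case: filterF => _ F0 _ _ h e Fe; have [/E_elim[//|[c [d [v ed]]]] _] := F0 _ Fe.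
by rewrite ed in Fe *; apply/A_Lambda_box => //; exact: h.
Qed.

(** A box whose closure misses [k] is disjoint from some box of [Lambda k], and a filter has no
    disjoint boxes. *)
Lemma A_Lambda_maximal k : A_ (@Lambda R k) `<=` F -> F = A_ (@Lambda R k).
Proof.
move=> AF; apply/seteqP; split=> //; apply: filter_sub_A => c d _ cd.
(* The successor puts [l] strictly beyond both end points, as [lam_disjoint] requires. *)
pose l := (c.1 + d.1 + odflt 0 k.1 + odflt 0 k.2).+1.
have vl : valid (lam k.1 l) (lam k.2 l).
  by rewrite /valid /l; case: k {AF} @l => -[a|] [b|] /=; lia.
have /AF lF : A_ (@Lambda R k) (box (lam k.1 l) (lam k.2 l)).
  apply/A_Lambda_box => //.
  by case: k {AF vl} @l => -[a|] [b|] /=; rewrite /in_ray /= ?eqxx.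
have /andP[/andP[m1 m1'] /andP[m2 m2']] := filter_meets lF cd.
apply/andP; split; apply: contraTT isT => no.
  by rewrite (lam_disjoint no _ m1) // in m1'; rewrite /l; lia.
by rewrite (lam_disjoint no _ m2) // in m2'; rewrite /l; lia.
Qed.

End Filters.

Lemma filter_A F : is_filter F -> exists k, F `<=` A_ (@Lambda R k).
Proof.
by move=> fF; have [k [h _ _]] := filter_boxes fF; exists k; exact: filter_sub_A.
Qed.

Lemma A_Lambda_ultra k : is_ultrafilter (A_ (@Lambda R k)).
Proof.
by split=> [|F fF AF]; [exact: A_Lambda_filter|exact: A_Lambda_maximal].
Qed.

End Semilattice.

(** * Characters and germs *)

(** The point [k] serves if it is at most [N], and otherwise the half line from [N]. This completes
    the factor [j] to a box within the range of an approximation of level [N]. *)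
Lemma exists_valid_right (k : nbar) j N : (j <= N)%N ->
  exists d, [/\ valid (j, false) d, (d.1 <= N)%N & in_lim d k].
Proof.
move=> jN; case: k => [i|]; last by exists (N, true); split.
have [iN|Ni] := leqP i N; first by exists (i, false); split=> //=; exact: eqxx.
by exists (N, true); split=> //; exact: ltnW.
Qed.

Lemma exists_valid_left (k : nbar) j N : (j <= N)%N ->
  exists c, [/\ valid c (j, false), (c.1 <= N)%N & in_lim c k].
Proof.
move=> /(exists_valid_right k)[c [v cN ck]]; exists c; split=> //.
by move: v; rewrite /valid /= !andbT.
Qed.

Section Characters.
Context (R : realType).
Local Notation box := (@box R).
Implicit Types (x y : char R) (e f s t : op R).

Lemma ev_val x (e : E R) : ev x (val e) = x e.
Proof. by rewrite /ev valK. Qed.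

Lemma ev_mem x a : ev x a -> E R a.
Proof. by rewrite /ev; case: insubP => // u /set_mem. Qed.

Lemma ev_ext x y : (forall a, E R a -> ev x a = ev y a) -> x = y.
Proof.
move=> h; apply: funext => e; rewrite -!ev_val; apply: h.
exact: set_mem (valP e).
Qed.

Lemma ev_phi k a : ev (phi R k) a <-> A_ (@Lambda R k) a.
Proof.
rewrite /ev; case: insubP => [e _ <-|aE]; first by split=> /asboolP.
by split=> // -[Ea]; rewrite mem_set in aE.
Qed.

Lemma ev_phi_box k c d : valid c d ->
  ev (phi R k) (box c d) = in_lim c k.1 && in_lim d k.2.
Proof.
by move=> v; apply/idP/idP => [/ev_phi/(A_Lambda_box R k v)|/(A_Lambda_box R k v)/ev_phi].
Qed.

Lemma ev_comp x e f : Ehat0 R x -> E R e -> E R f ->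
  ev x (e \o f) = ev x e && ev x f.
Proof.
move=> [_ _ xM] Ee Ef.
have := xM (SigSub (mem_set Ee)) (SigSub (mem_set Ef)).
by rewrite -!ev_val.
Qed.

Lemma Ehat0_id x : Ehat0 R x -> ev x idfun.
Proof.
move=> x0; have [[e xe] _ _] := x0.
have Ee : E R (val e) := set_mem (valP e).
by move: xe; rewrite -ev_val -[val e]/(idfun \o val e) (ev_comp x0 (id_E R) Ee) => /andP[].
Qed.

Lemma Ehat0_filter x : Ehat0 R x -> is_filter [set a | ev x a].
Proof.
move=> x0; have [_ x00 _] := x0; split.
- by exists idfun; exact: Ehat0_id.
- by move=> a /= xa; split=> [|a0]; [exact: ev_mem xa|rewrite a0 (negPf x00) in xa].
- move=> e f /= xe Ef; rewrite /op_le => fe; move: xe (ev_mem xe).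
  by rewrite -{1}fe => xfe Ee; move: xfe; rewrite ev_comp // => /andP[].
- by move=> e f /= xe xf; rewrite ev_comp ?xe ?xf //; [exact: ev_mem xe|exact: ev_mem xf].
Qed.

Lemma phi_Ehat0 k : Ehat0 R (phi R k).
Proof.
split.
- exists (SigSub (mem_set (id_E R))); rewrite -ev_val; apply/ev_phi.
  exact: A_Lambda_id.
- by apply/negP => /ev_phi/A_Lambda0.
- move=> e f; have Ee := set_mem (valP e); have Ef := set_mem (valP f).
  rewrite -!ev_val; apply/idP/andP.
    by move=> /ev_phi/(A_Lambda_comp k Ee Ef)[] ? ?; split; apply/ev_phi.
  by case=> /ev_phi ? /ev_phi ?; apply/ev_phi/A_Lambda_comp.
Qed.

Lemma ev_phiE k : [set a | ev (phi R k) a] = A_ (@Lambda R k).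
Proof. by apply/seteqP; split=> a /ev_phi. Qed.

(** An ultrafilter lies in some $A_{\Lambda(k)}$, itself a filter, so maximality makes them
    equal. *)
Lemma range_phi : range (phi R) = Ehat_inf R.
Proof.
apply/seteqP; split=> [_ [k _ <-]|x [x0 [xF xmax]]].
  by split; [exact: phi_Ehat0|rewrite ev_phiE; exact: A_Lambda_ultra].
have [k /(xmax _ (A_Lambda_filter R k)) xk] := filter_A xF.
exists k => //; apply: ev_ext => a _; move: (ev_phiE k); rewrite xk.
by move=> /(congr1 (fun S : set (op R) => S a)) /= h; apply/idP/idP; rewrite h.
Qed.

Lemma nbhs_ev x e : nbhs x [set y | ev y e = ev x e].
Proof.
(* Outside [E] every character takes the default value [false]. *)
have [Ee|nE] := pselect (E R e); last first.
  by apply: filterE => y /=; apply/idP/idP => /ev_mem.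
pose u : E R := SigSub (mem_set Ee).
have : nbhs x (proj u @^-1` [set x u]).
  exact: (@proj_continuous _ (fun=> bool) u x [set x u]).
by apply: filterS => y /=; rewrite /proj -!ev_val.
Qed.

(** Only finitely many boxes have end points at most [N], so agreeing with [x] on all of them
    defines a neighbourhood of [x], which meets the range of [phi]. *)
Lemma closure_Ehat_inf_approx x N : closure (Ehat_inf R) x ->
  exists k, forall c d, valid c d -> (c.1 <= N)%N -> (d.1 <= N)%N ->
    ev x (box c d) = in_lim c k.1 && in_lim d k.2.
Proof.
move=> clx; pose I : finType := (('I_N.+1 * bool) * ('I_N.+1 * bool))%type.
pose b (i : I) := box (i.1.1 : nat, i.1.2) (i.2.1 : nat, i.2.2).
have nx : nbhs x [set y | forall i, ev y (b i) = ev x (b i)].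
  exact: (filter_forall _ (fun i => nbhs_ev x (b i))).
have [y []] := clx _ nx; rewrite -range_phi => -[k _ <-] yx.
exists k => c d v cN dN; rewrite -ev_phi_box //.
have := yx ((Ordinal (cN : (c.1 < N.+1)%N), c.2), (Ordinal (dN : (d.1 < N.+1)%N), d.2)).
by rewrite /b /= -!surjective_pairing.
Qed.

Lemma Ehat_tightE : Ehat_tight R = range (phi R).
Proof.
apply/seteqP; split; last first.
  by rewrite range_phi => x xi; split; [case: xi|exact: subset_closure].
move=> x [x0 clx]; have xF := Ehat0_filter x0.
have [k [hk w1 w2]] := filter_boxes xF.
exists k => //; apply: ev_ext => e Ee; apply/idP/idP; last first.
  by move=> xa; apply/ev_phi; exact: (filter_sub_A xF hk xa).
case/E_elim: Ee => [->|[c [d [v ->]]]]; first by move/ev_phi/A_Lambda0.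
rewrite ev_phi_box // => /andP[hc hd].
(* Stating the bound conditionally lets [N], and with it [k'], be fixed before asking which
   coordinates are finite. *)
have [N1 hN1] : exists N, forall a, k.1 = Some a ->
    exists d', [/\ valid (a, false) d', ev x (box (a, false) d'),
                    (a <= N)%N & (d'.1 <= N)%N].
  case: k.1 w1 => [a w|_]; last by exists 0%N.
  by case: w => d' v' xd'; exists (a + d'.1)%N => i [<-]; exists d'; split=> //; lia.
have [N2 hN2] : exists N, forall b, k.2 = Some b ->
    exists c', [/\ valid c' (b, false), ev x (box c' (b, false)),
                    (b <= N)%N & (c'.1 <= N)%N].
  case: k.2 w2 => [b w|_]; last by exists 0%N.
  by case: w => c' v' xc'; exists (b + c'.1)%N => i [<-]; exists c'; split=> //; lia.
pose N := (N1 + N2 + c.1 + d.1)%N.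
have [k' hk'] := closure_Ehat_inf_approx N clx.
rewrite hk' //; [|by rewrite /N; lia..].
apply/andP; split.
  case k1: k.1 hc w1 => [a|] hc w1.
    (* The witness with first factor [a] also holds at [k'], which forces [k'.1] to be [a]. *)
    have [d' [v' xd' aN d'N]] := hN1 _ k1.
    move: xd'; rewrite hk' //=; [|by rewrite /N; lia..].
    case/andP=> + _; case: k'.1 => [a'|//] /=.
    by rewrite /in_ray /= => /eqP->.
  (* Here [c] is a half line. If [k'.1] were some [j] below it, [x] would be 1 on a box with first
     factor [j], which [w1] excludes. *)
  case k1': k'.1 => [j|//]; rewrite /=.
  rewrite /in_ray; rewrite /= in hc; rewrite hc leqNgt; apply/negP => jc.
  have jN : (j <= N)%N by rewrite /N; lia.
  have [d' [v' d'N kd']] := exists_valid_right k'.2 jN.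
  by apply: (w1 j d' v'); rewrite /= hk' // k1' kd' /= /in_ray /= eqxx.
case k2: k.2 hd w2 => [b|] hd w2.
  have [c' [v' xc' bN c'N]] := hN2 _ k2.
  move: xc'; rewrite hk' //=; [|by rewrite /N; lia..].
  case/andP=> _; case: k'.2 => [b'|//] /=.
  by rewrite /in_ray /= => /eqP->.
case k2': k'.2 => [j|//]; rewrite /=.
rewrite /in_ray; rewrite /= in hd; rewrite hd leqNgt; apply/negP => jd.
have jN : (j <= N)%N by rewrite /N; lia.
have [c' [v' c'N kc']] := exists_valid_left k'.1 jN.
by apply: (w2 j c' v'); rewrite /= hk' // k2' kc' /= /in_ray /= eqxx.
Qed.

End Characters.

(** * The groupoid of germs and its units *)

Section Groupoid.
Context (R : realType).
Implicit Types (x y : char R) (e f s t : op R).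

Lemma adj_id : adj idfun = idfun :> op R.
Proof. by rewrite idE restrict_adj. Qed.

Lemma act_id x : act x idfun = x.
Proof. by apply: funext => e; rewrite /act adj_id -ev_val. Qed.

Lemma Sigma_id x : Ehat0 R x -> Sigma (x, idfun : op R).
Proof.
move=> x0; split; first by case: (id_E R).
by split=> //=; rewrite adj_id; exact: Ehat0_id.
Qed.

Lemma germ_rel_refl x t : Ehat0 R x -> germ_rel (x, t) (x, t).
Proof. by move=> x0; split=> //; exists idfun; split=> //; [exact: id_E|exact: Ehat0_id]. Qed.

Lemma germ_relC (p q : char R * op R) : germ_rel p q -> germ_rel q p.
Proof. by move=> [pq [e [Ee pe eq]]]; split=> //; exists e; split=> //; rewrite -pq. Qed.

(** Witnesses commute, so the product of two of them witnesses both relations. *)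
Lemma germ_rel_trans (p q r : char R * op R) : Ehat0 R p.1 ->
  germ_rel p q -> germ_rel q r -> germ_rel p r.
Proof.
move=> p0 [pq [e [Ee pe eq]]] [qr [f [Ef qf fr]]]; split; first by rewrite pq.
exists (e \o f); split; first exact: E_comp.
  by rewrite ev_comp // pe pq qf.
rewrite -[RHS]/(e \o (f \o r.2)) -fr (E_comm Ee Ef).
rewrite -[LHS]/(f \o (e \o p.2)) eq.
by rewrite -[RHS]/((e \o f) \o q.2) (E_comm Ee Ef).
Qed.

Lemma eq_germ x s t : Ehat0 R x -> germ_rel (x, s) (x, t) -> germ x s = germ x t.
Proof.
move=> x0 st; apply/seteqP; split=> q [Sq sq]; split=> //.
  exact: germ_rel_trans (germ_relC st) sq.
exact: germ_rel_trans st sq.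
Qed.

(** The pair [(x, s)] lies in its own germ, hence in the other one. *)
Lemma germ_eqP x s y t : Sigma (x, s) -> germ x s = germ y t ->
  y = x /\ germ_rel (x, s) (x, t).
Proof.
move=> Sx eq; have x0 : Ehat0 R x by case: Sx => _ [].
have : germ x s (x, s) by split=> //; exact: germ_rel_refl.
by rewrite eq => -[_ h]; have [/= yx _] := h; subst y; split=> //; exact: germ_relC.
Qed.

Lemma unit_germ_inj x y : Ehat0 R x -> unit_germ R x = unit_germ R y -> x = y.
Proof. by move=> x0 /(germ_eqP (Sigma_id x0))[->]. Qed.

Lemma unit_germ_unit x : Ehat_tight R x -> unit_space (Gtight R) (unit_germ R x).
Proof.
move=> xt; have x0 : Ehat0 R x by case: xt.
have Sx := Sigma_id x0; exists (unit_germ R x), (unit_germ R x); split.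
- by exists x, idfun; split=> //; rewrite act_id.
- by exists x, idfun; split=> //; rewrite act_id adj_id.
- by exists x, idfun, idfun; split=> //; rewrite act_id.
Qed.

(** Inversion and product may present the same arrows by different representatives; this reconciles
    them. *)
Lemma germ_inv_mul x s' t t' : Ehat0 R x -> T R s' -> T R t ->
  germ_rel (x, s') (x, t) -> germ_rel (act x s', adj s') (act x t, t') ->
  germ_rel (x, t \o t') (x, idfun).
Proof.
move=> x0 Ts' Tt [_ [e [Ee /= xe es]]] [/= eact [f [Ef xf ft]]].
pose u : E R := SigSub (mem_set Ef).
have act_f r : ev (act x r) f = ev x (r \o f \o adj r).
  by rewrite -[f]/(val u) ev_val.
(* As [act x s'] and [act x t] coincide, [x] is 1 at both conjugates of [f], which therefore lie in
   [E]. *)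
have xs' := xf; rewrite act_f in xs'.
have xt := xf; rewrite eact act_f in xt.
have Es' := ev_mem xs'; have Et := ev_mem xt.
have tK : f \o (adj t \o t) = (adj t \o t) \o f.
  have [Q ->] := T_adj_comp_restrict Tt; have [Q' ->] := E_restrict Ef.
  exact: restrictC.
(* Both sides are (e r) f (e r)^* , for r = t and for r = s'. *)
have gh : e \o (t \o f \o adj t) = e \o (s' \o f \o adj s').
  have conj_E r : T R r -> E R (r \o f \o adj r) ->
      e \o (r \o f \o adj r) = (e \o r) \o f \o adj (e \o r).
    move=> Tr Er; rewrite (adj_comp_E Ee Tr).
    have [_ ee _] := Ee.
    rewrite -[RHS]/(e \o (r \o f \o adj r) \o e) -[RHS]compA (E_comm Er Ee).
    by rewrite -[RHS]/((e \o e) \o (r \o f \o adj r)) ee.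
  by rewrite !conj_E // es.
split=> //; exists (e \o (t \o f \o adj t)); split; first exact: E_comp.
  by rewrite ev_comp // xe.
(* Moving [f] past [adj t \o t] reduces the left side to [e \o t \o f \o t']; the witnesses turn
   this into [e \o s' \o f \o adj s'], and [gh] concludes. *)
rewrite -[LHS]/(e \o t \o (f \o (adj t \o t)) \o t') tK.
rewrite -[LHS]/(e \o (t \o adj t \o t) \o (f \o t')) (T_adjK Tt) -ft -es.
exact: esym gh.
Qed.

Lemma unit_space_unit_germ a : unit_space (Gtight R) a ->
  exists2 x, Ehat_tight R x & a = unit_germ R x.
Proof.
move=> [g [b [[x [s [Sxs eg xt _]]] [y [s' [Sys' eg' eb]]]
  [z [t [t' [Szt Szt' eg'' eb' ->]]]]]]].
have x0 : Ehat0 R x by case: xt.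
(* The arrow [g] is presented three times, by membership, inversion and product, always over the
   same character [x]. *)
have [yx _] := germ_eqP Sxs (etrans (esym eg) eg'); subst y.
have [zx ts'] := germ_eqP Sys' (etrans (esym eg') eg''); subst z.
have act0 : Ehat0 R (act x t) by case: Szt' => _ [].
have [eact tt'] := germ_eqP Szt' (etrans (esym eb') eb).
exists x => //; apply: eq_germ => //; apply: (@germ_inv_mul x s' t t') => //.
- by case: Sys'.
- by case: Szt.
- by rewrite eact; apply: germ_relC.
Qed.

End Groupoid.

Theorem lemma4p1 (R : realType) :
  set_bij (range (phi R)) (unit_space (Gtight R)) (unit_germ R) /\
  range (phi R) = Ehat_inf R.
Proof.
split; last exact: range_phi.
rewrite -Ehat_tightE; split.
- by move=> x; exact: unit_germ_unit.
- by move=> x y /set_mem[x0 _] _; exact: unit_germ_inj.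
- by move=> a /unit_space_unit_germ[x xt ->]; exists x.
Qed.
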